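(* Let $(A,B)$ be a suitable pair of $k$-tuples and let $m\ge1$ be an integer. Then \[S_{m-1}(A,B) = \frac{m!}{m}\sum\left(\prod_{i=0}^k\frac{B_{x_i}}{x_i!}\right) \frac{\prod_{i=1}^k a_i^{\alpha(i)} b_i^{\beta(i)}} {\prod_{j=1}^{k}(y_j+1)!}-\frac{B_m}{m},\] where the sum runs over all tuples of non-negative integers $(x_0,\dots,x_k,y_1,\dots,y_k)$ with $\sum_{i=0}^kx_i+\sum_{j=1}^ky_j=m$, and $\alpha(i)=\sum_{\ell=1}^{i}(x_{\ell-1}+y_{\ell})$, $\beta(i)=\sum_{\ell=i}^k (x_\ell+y_{\ell})$.
   Context: A pair $A=(a_1,\dots,a_k)$, $B=(b_1,\dots,b_k)$ of $k$-tuples of positive integers is suitable if $\gcd(a_i,b_j)=1$ for all $i\ge j$. Its compound sequence is $g_i=b_1\cdots b_ia_{i+1}\cdots a_k$, $0\le i\le k$. $\mathit{NR}(A,B)$ is the finite set of non-negative integers not expressible as non-negative integer combinations of $g_0,\dots,g_k$, and $S_m(A,B)=\sum_{n\in\mathit{NR}(A,B)}n^m$. $B_0,B_1,B_2,\dots$ are the Bernoulli numbers, defined by $\frac{z}{e^z-1}=\sum_{n\ge0}B_n\frac{z^n}{n!}$. *)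

(* Defs.v *)
From mathcomp Require Import all_boot all_order all_algebra.
From mathcomp Require Import boolp classical_sets cardinality fsbigop.

Set Implicit Arguments.
Unset Strict Implicit.
Unset Printing Implicit Defensive.
Import Order.TTheory GRing.Theory Num.Theory.

Local Open Scope ring_scope.

(* A k-tuple (c_1, ..., c_k) is a function c : 'I_k -> nat, the entry c_i      *)
(* being the value of c at the ordinal i - 1.                                 *)

Definition suitable (k : nat) (A B : 'I_k -> nat) : Prop :=
  [/\ forall i, (0 < A i)%N,
      forall i, (0 < B i)%N &
      forall i j : 'I_k, (j <= i)%N -> coprime (A i) (B j)].

Definition compound (k : nat) (A B : 'I_k -> nat) (i : 'I_k.+1) : nat :=
  ((\prod_(j < k | (j < i)%N) B j) * (\prod_(j < k | (i <= j)%N) A j))%N.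

Definition representable (k : nat) (A B : 'I_k -> nat) (n : nat) : Prop :=
  exists c : 'I_k.+1 -> nat, n = (\sum_(i < k.+1) c i * compound A B i)%N.

Definition NR (k : nat) (A B : 'I_k -> nat) : set nat :=
  [set n | ~ representable A B n]%classic.

(* The sum over a set that is not finite would be the junk value 0; lemma     *)
(* finite_NR below shows that NR A B is finite for a suitable pair.           *)
Definition power_sum_NR (m k : nat) (A B : 'I_k -> nat) : rat :=
  \sum_(n \in NR A B) (n%:R : rat) ^+ m.

Section FiniteNR.
Variables (k : nat) (A B : 'I_k -> nat).

Let representableD n p :
  representable A B n -> representable A B p -> representable A B (n + p).
Proof.
move=> [c ->] [d ->]; exists (fun i => c i + d i)%N.
by rewrite -big_split; apply: eq_bigr => i _; rewrite mulnDl.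
Qed.

Let representableM q n : representable A B n -> representable A B (q * n).
Proof.
move=> [c ->]; exists (fun i => q * c i)%N.
by rewrite big_distrr; apply: eq_bigr => i _; rewrite /= mulnA.
Qed.

Let representable0 : representable A B 0.
Proof. by exists (fun=> 0%N); rewrite big1. Qed.

Let representable_compound i : representable A B (compound A B i).
Proof.
exists (fun j => (j == i) : nat); rewrite (bigD1 i) //= eqxx mul1n big1 ?addn0 //.
by move=> j /negPf ->.
Qed.

Let representable_gap : exists p,
  representable A B p /\
  representable A B (p + \big[gcdn/0%N]_(i < k.+1) compound A B i).
Proof.
elim/big_rec: _ => [|i d _ [p [rp rpd]]]; first by exists 0%N; rewrite addn0.
have [->|d_gt0] := posnP d.
  by exists 0%N; rewrite gcdn0 add0n.
case: (egcdnP (compound A B i) d_gt0) => u v E _.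
exists (u * p + v * compound A B i)%N; split.
  by apply: representableD; apply: representableM.
rewrite gcdnC -addnA -E -mulnDr; exact: representableM.
Qed.

Hypothesis sAB : suitable A B.

Let compound_gcd1 : \big[gcdn/0%N]_(i < k.+1) compound A B i = 1%N.
Proof.
have [A0 B0 cop] := sAB.
set d := \big[_/_]_(_ < _) _; apply/eqP/negPn/negP => d1.
have d_dvd i : (d %| compound A B i)%N by apply: (biggcdn_inf i).
have c0 i : (0 < compound A B i)%N.
  by rewrite muln_gt0; apply/andP; split; rewrite prodn_cond_gt0.
have d0 : (0 < d)%N by apply: dvdn_gt0 (c0 ord0) (d_dvd ord0).
have p_pr : prime (pdiv d) by apply: pdiv_prime; rewrite ltn_neqAle eq_sym d1.
set p := pdiv d in p_pr.
have p_dvd i : (p %| compound A B i)%N := dvdn_trans (pdiv_dvd d) (d_dvd i).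
have dvd_prod (F : 'I_k -> nat) (P : pred 'I_k) :
    (p %| \prod_(j < k | P j) F j)%N -> exists2 j, P j & (p %| F j)%N.
  elim/big_rec: _ => [|j x Pj IH]; first by rewrite dvdn1 => /eqP p1; rewrite p1 in p_pr.
  by rewrite Euclid_dvdM // => /orP[|/IH //]; exists j.
have [j0 _ pj0] : exists2 j : 'I_k, true & (p %| A j)%N.
  apply: dvd_prod; have := p_dvd ord0.
  by rewrite /compound big_pred0 ?mul1n.
have [j pj jmax] := @arg_maxnP _ j0 (fun j => p %| A j)%N (fun j => j : nat) pj0.
have := p_dvd (lift ord0 j); rewrite /compound Euclid_dvdM // => /orP[] /dvd_prod [l].
  rewrite lift0 ltnS => lj pl; have := cop _ _ lj; rewrite /coprime => /eqP g1.
  by have := dvdn_gcd p (A j) (B l); rewrite pj pl g1 dvdn1 => /eqP p1; rewrite p1 in p_pr.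
by rewrite lift0 => jl /jmax; rewrite /= leqNgt jl.
Qed.

Lemma finite_NR : finite_set (NR A B).
Proof.
have [p [rp]] := representable_gap; rewrite compound_gcd1 addn1 => rp1.
apply: (@sub_finite_set _ _ `I_(p.+1 * p)%N); last exact: finite_II.
move=> n; rewrite /NR /= => nr; rewrite ltnNge; apply/negP => le_n; apply: nr.
have [p0|p_gt0] := posnP p.
  by rewrite -[n]muln1; apply: representableM; rewrite -[1%N]/(0.+1) -p0.
have le_r : (n %% p <= n %/ p)%N.
  rewrite leq_divRL //; apply: leq_trans le_n.
  by rewrite leq_mul2r (leq_trans (ltnW (ltn_pmod n p_gt0))) ?orbT.
have -> : n = ((n %/ p - n %% p) * p + (n %% p) * p.+1)%N.
  by rewrite mulnS addnCA -mulnDl subnK // addnC -divn_eq.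
by apply: representableD; apply: representableM.
Qed.

End FiniteNR.

(* A formal power series over rat is its sequence of coefficients.            *)
Definition fps_mul (f g : nat -> rat) : nat -> rat :=
  fun n => \sum_(i < n.+1) f i * g (n - i)%N.

Definition fps_X : nat -> rat := fun n => (n == 1%N)%:R.

Definition fps_one : nat -> rat := fun n => (n == 0%N)%:R.

Definition fps_exp : nat -> rat := fun n => (n`!)%:R^-1.

Definition fps_egf (b : nat -> rat) : nat -> rat := fun n => b n / (n`!)%:R.

(* z / (e^z - 1) = \sum_n b n z^n / n! in rat[[z]], with the denominator      *)
(* cleared (e^z - 1 is not invertible in rat[[z]], but it is not a zero       *)
(* divisor, so that the equation determines b: see bernoulli_unique).         *)
Definition bernoulli_spec (b : nat -> rat) : Prop :=
  fps_mul (fps_egf b) (fps_exp \- fps_one) = fps_X.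

Lemma bernoulli_specE (b : nat -> rat) : bernoulli_spec b <->
  forall n, fps_egf b n =
    (n == 0%N)%:R - \sum_(i < n) fps_egf b i / ((n.+1 - i)`!)%:R.
Proof.
have E n : fps_mul (fps_egf b) (fps_exp \- fps_one) n.+1 =
    \sum_(i < n) fps_egf b i / ((n.+1 - i)`!)%:R + fps_egf b n.
  rewrite /fps_mul !big_ord_recr /= subnn subSnn /fps_exp /fps_one /=.
  rewrite !fact0 invr1 subrr mulr0 addr0 subr0 mulr1; congr (_ + _).
  apply: eq_bigr => i _; congr (_ * _).
  by rewrite subn_eq0 leqNgt (leq_trans (ltn_ord i)) //= subr0.
split=> [H n | H].
  by rewrite -[(n == 0%N)%:R]/(fps_X n.+1) -H E addrAC subrr add0r.
apply/funext => -[|n]; last by rewrite E H addrC subrK.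
by rewrite /fps_mul big_ord1 /fps_exp /fps_one /= invr1 subrr mulr0.
Qed.

Lemma bernoulli_exists : exists b, bernoulli_spec b.
Proof.
pose fix s n : seq rat := if n is p.+1 then
  rcons (s p) ((p == 0%N)%:R - \sum_(i < p) (s p)`_i / ((p.+1 - i)`!)%:R)
  else [::].
have size_s n : size (s n) = n by elim: n => //= n IH; rewrite size_rcons IH.
pose c n := (s n.+1)`_n.
have sE n i : (i < n)%N -> (s n)`_i = c i.
  elim: n => // n IH; rewrite ltnS leq_eqVlt => /predU1P[-> //|lt_in].
  by rewrite /= nth_rcons size_s lt_in IH.
exists (fun n => c n * (n`!)%:R); apply/bernoulli_specE => n.
have E i : fps_egf (fun n => c n * (n`!)%:R) i = c i.
  by rewrite /fps_egf mulfK // pnatr_eq0 -lt0n fact_gt0.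
rewrite E {1}/c /= nth_rcons size_s ltnn eqxx; congr (_ - _).
by apply: eq_bigr => i _; rewrite E sE.
Qed.

Lemma bernoulli_unique (b c : nat -> rat) :
  bernoulli_spec b -> bernoulli_spec c -> b = c.
Proof.
move=> /bernoulli_specE Hb /bernoulli_specE Hc; apply/funext => n.
suff E : fps_egf b n = fps_egf c n.
  have n0 : (n`!)%:R != 0 :> rat by rewrite pnatr_eq0 -lt0n fact_gt0.
  by apply: (mulIf (invr_neq0 n0)).
elim/ltn_ind: n => n IH; rewrite Hb Hc; congr (_ - _).
by apply: eq_bigr => i _; rewrite IH.
Qed.

Definition bernoulli : nat -> rat := sval (cid bernoulli_exists).

Lemma bernoulliP : bernoulli_spec bernoulli.
Proof. exact: (svalP (cid bernoulli_exists)). Qed.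

(* alpha(i) = \sum_(l = 1)^i (x_(l-1) + y_l) and                              *)
(* beta(i) = \sum_(l = i)^k (x_l + y_l); in both, the ordinal l of the code   *)
(* stands for the index l + 1.                                                *)
Definition alpha (k : nat) (x : 'I_k.+1 -> nat) (y : 'I_k -> nat) (i : 'I_k)
    : nat :=
  (\sum_(l < k | (l <= i)%N) (x (widen_ord (leqnSn k) l) + y l))%N.

Definition beta (k : nat) (x : 'I_k.+1 -> nat) (y : 'I_k -> nat) (i : 'I_k)
    : nat :=
  (\sum_(l < k | (i <= l)%N) (x (lift ord0 l) + y l))%N.

(* Main.v *)
Require Import Defs.
From HB Require Import structures.
From mathcomp Require Import all_boot all_order all_algebra.
From mathcomp Require Import boolp classical_sets functions fsbigop.
From mathcomp Require Import zify ring.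

Set Implicit Arguments.
Unset Strict Implicit.
Unset Printing Implicit Defensive.
Import Order.TTheory GRing.Theory Num.Theory.
Local Open Scope ring_scope.

(* Every representable number is uniquely c_0 g_0 + c_1 g_1 + ... + c_k g_k with
   c_i < a_i for i >= 1, so the numbers c_1 g_1 + ... + c_k g_k form the Apéry
   set of the semigroup with respect to g_0: one element per residue class mod
   g_0, below which all members of the class are gaps.  Summing geometric
   progressions,
     (t^g_0 - 1) sum_{n in NR} t^n =
       prod_{i >= 1} (t^(a_i g_i) - 1)/(t^g_i - 1) - (t^g_0 - 1)/(t - 1).
   At t = e^z, with B(z) = z/(e^z - 1), E(z) = (e^z - 1)/z and
   g_0 = a_1 ... a_k, this becomes
     z sum_{n in NR} e^(n z) =
       prod_{i >= 0} B(g_i z) prod_{j >= 1} E(a_j g_j z) - B(z),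
   and the theorem compares the coefficients of z^m. *)

(** * The ring of formal power series *)

Definition trunc (N : nat) (f : nat -> rat) : {poly rat} :=
  \poly_(i < N.+1) f i.

Lemma coef_trunc N f n : (n <= N)%N -> (trunc N f)`_n = f n.
Proof. by move=> le_nN; rewrite coef_poly ltnS le_nN. Qed.

(** The coefficient of z^n in a product involves only coefficients of index at most n. Truncating to
    polynomials therefore transfers the ring laws of [{poly rat}] to series. *)
Lemma fps_mul_coef (p q : {poly rat}) (f g : nat -> rat) N n :
  (n <= N)%N -> (forall i, (i <= N)%N -> p`_i = f i) ->
  (forall i, (i <= N)%N -> q`_i = g i) -> (p * q)`_n = fps_mul f g n.
Proof.
move=> le_nN pf qg; rewrite coefM; apply: eq_bigr => i _.
by rewrite pf ?qg //; have := ltn_ord i; lia.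
Qed.

Lemma fps_mulA : associative fps_mul.
Proof.
move=> f g h; apply/funext => n.
have tr f' i : (i <= n)%N -> (trunc n f')`_i = f' i by apply: coef_trunc.
have trM f' g' i : (i <= n)%N -> (trunc n f' * trunc n g')`_i = fps_mul f' g' i.
  by move=> le_in; apply: (fps_mul_coef le_in) => j ?; apply: tr; lia.
transitivity (trunc n f * (trunc n g * trunc n h))`_n.
  by symmetry; apply: (@fps_mul_coef _ _ _ _ n) => // i; [apply: tr | apply: trM].
by rewrite mulrA; apply: (@fps_mul_coef _ _ _ _ n) => // i; [apply: trM | apply: tr].
Qed.

Lemma fps_mulC : commutative fps_mul.
Proof.
move=> f g; apply/funext => n.
have E f' g' : fps_mul f' g' n = (trunc n f' * trunc n g')`_n.
  by symmetry; apply: (@fps_mul_coef _ _ _ _ n) => // i; apply: coef_trunc.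
by rewrite !E mulrC.
Qed.

Lemma fps_mul1 : left_id fps_one fps_mul.
Proof.
move=> f; apply/funext => n; rewrite /fps_mul big_ord_recl /fps_one mul1r subn0.
by rewrite big1 ?addr0 // => i _; rewrite mul0r.
Qed.

Lemma fps_mulDl : left_distributive fps_mul +%R.
Proof.
move=> f g h; apply/funext => n; rewrite !addrfctE /fps_mul -big_split /=.
by apply: eq_bigr => i _; rewrite mulrDl.
Qed.

(* An alias, because [nat -> rat] already carries the pointwise product. *)
Definition fps := nat -> rat.
HB.instance Definition _ := GRing.Zmodule.copy fps (nat -> rat).
HB.instance Definition _ :=
  GRing.Zmodule_isComPzRing.Build fps fps_mulA fps_mulC fps_mul1 fps_mulDl.

Lemma fpsD (f g : fps) n : (f + g) n = f n + g n. Proof. by []. Qed.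
Lemma fpsB (f g : fps) n : (f - g) n = f n - g n. Proof. by []. Qed.
Lemma fps1 n : (1 : fps) n = (n == 0%N)%:R. Proof. by []. Qed.
Lemma fpsM (f g : fps) n : (f * g) n = \sum_(i < n.+1) f i * g (n - i)%N.
Proof. by []. Qed.

Lemma fps_sum I (r : seq I) (P : pred I) (F : I -> fps) n :
  (\sum_(i <- r | P i) F i) n = \sum_(i <- r | P i) F i n.
Proof.
by elim/big_ind2: _ => // f x g y; rewrite fpsD => -> ->.
Qed.

Lemma fps_natmul (f : fps) c n : (f *+ c) n = f n *+ c.
Proof. by elim: c => // c IH; rewrite !mulrS fpsD IH. Qed.

Definition fX : fps := fps_X.

Lemma fps_mulXS (f : fps) n : (f * fX) n.+1 = f n.
Proof.
rewrite mulrC fpsM big_ord_recl mul0r add0r big_ord_recl /= mul1r subSS subn0.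
by rewrite big1 ?addr0 // => i _; rewrite mul0r.
Qed.

(** Since z is not invertible, division by z is replaced by cancellation throughout. *)
Lemma fps_mulIX (f g : fps) : f * fX = g * fX -> f = g.
Proof. by move=> fg; apply/funext => n; rewrite -fps_mulXS fg fps_mulXS. Qed.

Lemma fps_mulIn (f g : fps) c : (0 < c)%N -> f *+ c = g *+ c -> f = g.
Proof.
move=> c0 fg; apply/funext => n; have := congr1 (fun h : fps => h n) fg.
rewrite /= !fps_natmul => /eqP; rewrite eqrMn2r => /predU1P[c00|/eqP//].
by rewrite c00 in c0.
Qed.

(** * Exponential series and the substitution z -> c z *)

Definition fscale (c : nat) (f : nat -> rat) : fps := fun n => c%:R ^+ n * f n.

Lemma fscaleM c (f g : fps) : fscale c (f * g) = fscale c f * fscale c g.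
Proof.
apply/funext => n; rewrite /fscale !fpsM mulr_sumr; apply: eq_bigr => i _.
by rewrite mulrACA -exprD subnKC // -ltnS.
Qed.

Lemma fscale1 c : fscale c (1 : fps) = 1.
Proof.
apply/funext => -[|n]; first by rewrite /fscale expr0 mul1r.
by rewrite /fscale fps1 mulr0.
Qed.

Lemma fscale_id (f : nat -> rat) : fscale 1 f = f.
Proof. by apply/funext => n; rewrite /fscale expr1n mul1r. Qed.

Lemma fact_neq0 n : (n`!)%:R != 0 :> rat.
Proof. by rewrite pnatr_eq0 -lt0n fact_gt0. Qed.

(** By the binomial theorem, e^((a+b)z) = e^(az) e^(bz). *)
Lemma fscale_expD a b :
  fscale (a + b) fps_exp = fscale a fps_exp * fscale b fps_exp.
Proof.
apply/funext => n; rewrite /fscale fpsM natrD addrC exprDn mulr_suml.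
apply: eq_bigr => i _; have le_in : (i <= n)%N by rewrite -ltnS.
have := bin_fact le_in; move/(congr1 (fun x => x%:R : rat)); rewrite !natrM.
rewrite -mulr_natr /fps_exp => E; rewrite mulrACA -E.
have Hb : 'C(n, i)%:R != 0 :> rat by rewrite pnatr_eq0 -lt0n bin_gt0.
by field; rewrite Hb !fact_neq0.
Qed.

Definition fe : fps := fps_exp.

Lemma feX n : fe ^+ n = fscale n fps_exp.
Proof.
elim: n => [|n IH].
  by apply/funext => -[|n]; rewrite expr0 /fscale /fps_exp ?mul1r ?invr1 ?expr0n ?mul0r.
by rewrite exprSr IH -addn1 fscale_expD fscale_id.
Qed.

(* The series (e^z - 1) / z. *)
Definition fE : fps := fun n => (n.+1`!)%:R^-1.

Definition fB : fps := fps_egf bernoulli.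

(** Writing e^(nz) - 1 as n z E(nz) isolates the non-invertible factor z; what remains, E(nz), has
    the inverse B(nz). *)
Lemma feX_sub1 n : fe ^+ n - 1 = (fscale n fE * fX) *+ n.
Proof.
rewrite feX; apply/funext => -[|i]; rewrite fpsB fps_natmul.
  by rewrite fpsM big_ord1 mulr0 mul0rn fps1 /fscale expr0 mul1r /fps_exp invr1 subrr.
by rewrite fps_mulXS fps1 subr0 /fscale exprS -mulrA mulr_natl.
Qed.

Lemma fB_fE c : fscale c fB * fscale c fE = 1.
Proof.
rewrite -fscaleM -[RHS](fscale1 c); congr fscale; apply: fps_mulIX.
rewrite mul1r -mulrA -[fE]fscale_id -[_ * fX]mulr1n -feX_sub1 expr1.
exact: bernoulliP.
Qed.

Lemma sum_feX a g : (0 < g)%N ->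
  \sum_(c < a) fe ^+ (c * g)%N = (fscale (a * g) fE * fscale g fB) *+ a.
Proof.
move=> g0; set s := \sum_(_ < _) _.
have : (fe ^+ g - 1) * s = fe ^+ (a * g)%N - 1.
  rewrite mulnC exprM [RHS]subrX1; congr (_ * _).
  by apply: eq_bigr => c _; rewrite -exprM mulnC.
(* Both sides are now multiples of g z, which cancels; multiplying by B(gz) then removes E(gz). *)
rewrite !feX_sub1 mulrnAl mulrnA mulrAC -[(_ * fX) *+ a]mulrnAl.
move/(fps_mulIn g0)/fps_mulIX => /(congr1 ( *%R (fscale g fB))).
by rewrite mulrA fB_fE mul1r mulrC mulrnAl.
Qed.

(** * Coefficients of finite products of series *)

Lemma coef_fps_prod (I : finType) (p : I -> {poly rat}) (f : I -> fps) N n :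
  (n <= N)%N -> (forall j i, (i <= N)%N -> (p j)`_i = f j i) ->
  (\prod_j p j)`_n = (\prod_j f j) n.
Proof.
move=> + pf; elim/big_ind2: _ n => [|q g r h IHg IHh n le_n | j _ n le_n].
- by move=> n _; rewrite coef1.
- exact: (fps_mul_coef le_n).
- exact: pf.
Qed.

Lemma fps_prod2E (I J : finType) (f : I -> fps) (g : J -> fps) m :
  ((\prod_i f i) * (\prod_j g j)) m =
  \sum_(x : {ffun I -> 'I_m.+1})
    \sum_(y : {ffun J -> 'I_m.+1} | (\sum_i x i + \sum_j y j == m)%N)
      (\prod_i f i (x i)) * (\prod_j g j (y j)).
Proof.
have expand (K : finType) (h : K -> fps) :
    \prod_k trunc m (h k) =
    \sum_(x : {ffun K -> 'I_m.+1}) (\prod_k h k (x k)) *: 'X^(\sum_k x k)%N.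
  under eq_bigr do rewrite /trunc poly_def.
  rewrite bigA_distr_bigA; apply: eq_bigr => x _.
  by rewrite scaler_prod prodrXr.
(* Truncating every factor at degree m leaves the coefficient of z^m unchanged and makes the
   expansion a finite sum over exponent tuples. *)
rewrite -[LHS](@fps_mul_coef (\prod_i trunc m (f i)) (\prod_j trunc m (g j)) _ _ m) //;
  try by move=> i ?; apply: (@coef_fps_prod _ _ _ m) => // *; apply: coef_trunc.
rewrite !expand mulr_suml coef_sum; apply: eq_bigr => x _.
rewrite mulr_sumr coef_sum [RHS]big_mkcond; apply: eq_bigr => y _.
rewrite -scalerAl -scalerAr scalerA -exprD coefZ coefXn eq_sym.
by case: eqP; rewrite ?mulr1 ?mulr0.
Qed.

(** * Apéry sets *)

Lemma prod_maxE k (F : 'I_k.+1 -> nat) :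
  (\prod_(j < k.+1) F j = F ord_max * \prod_(j < k) F (widen_ord (leqnSn k) j))%N.
Proof. by rewrite big_ord_recr /= mulnC. Qed.

(** * Removing the last entries of the two tuples *)

Section Truncation.
Variables (k : nat) (A B : 'I_k.+1 -> nat).
Let A' (i : 'I_k) := A (widen_ord (leqnSn k) i).
Let B' (i : 'I_k) := B (widen_ord (leqnSn k) i).

Lemma compound_widen i :
  compound A B (widen_ord (leqnSn k.+1) i) = (A ord_max * compound A' B' i)%N.
Proof.
rewrite /compound big_mkcond big_ord_recr /= -big_mkcond /=.
rewrite [X in (_ * X)%N]big_mkcond big_ord_recr /= -big_mkcond /=.
have lt_ik := ltn_ord i; rewrite ltnS in lt_ik.
rewrite ltnNge lt_ik /= muln1; ring.
Qed.

Lemma compound_max : compound A B ord_max = (\prod_(j < k.+1) B j)%N.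
Proof.
rewrite /compound [X in (_ * X)%N]big_pred0 ?muln1 => [|j]; last by rewrite leqNgt ltn_ord.
by apply: eq_bigl => j; rewrite ltn_ord.
Qed.

(** With a, b the last entries, this says that a copies of the last generator can be exchanged for b
    copies of the preceding one. *)
Lemma compound_max_step :
  (A ord_max * compound A B ord_max =
   B ord_max * (A ord_max * compound A' B' ord_max))%N.
Proof.
rewrite compound_max prod_maxE /compound mulnCA; congr (_ * (_ * _))%N.
rewrite [X in (_ * X)%N]big_pred0 ?muln1 => [|j]; last by rewrite leqNgt ltn_ord.
by apply: eq_bigl => j; rewrite ltn_ord.
Qed.

Lemma representable_step n : (0 < A ord_max)%N ->
  representable A B n <->
  exists c n', [/\ (c < A ord_max)%N, representable A' B' n' &
                   n = (c * compound A B ord_max + A ord_max * n')%N].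
Proof.
move=> a0; split=> [[c ->]|[c [n' [_ [d ->] ->]]]].
  exists (c ord_max %% A ord_max)%N.
  (* The last coefficient is reduced modulo [A ord_max]; its quotient, times [B ord_max], is carried
     to the preceding generator. *)
  exists (\sum_(i < k.+1)
    (c (widen_ord (leqnSn _) i) + (i == ord_max) * (c ord_max %/ A ord_max * B ord_max))
      * compound A' B' i)%N.
  split; [by rewrite ltn_mod | by eexists | ].
  under [X in (_ + _ * X)%N]eq_bigr do rewrite mulnDl.
  rewrite big_split /= mulnDr [X in (_ + (_ + _ * X))%N](bigD1 ord_max) //=.
  rewrite [X in (_ + (_ + _ * (_ + X)))%N]big1 ?addn0; last by move=> i /negPf ->.
  rewrite eqxx mul1n big_ord_recr /= addnC [in LHS](divn_eq (c ord_max) (A ord_max)).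
  rewrite mulnDl -[(_ * _ * compound _ _ _)%N]mulnA compound_max_step.
  rewrite -addnA addnCA; congr (_ + _)%N.
  rewrite addnC; congr (_ + _)%N; last by ring.
  by rewrite big_distrr; apply: eq_bigr => i _; rewrite compound_widen /= mulnCA.
exists (fun i => if unlift ord_max i is Some j then d j else c).
rewrite [RHS]big_ord_recr unlift_none /= addnC; congr (_ + _)%N.
rewrite big_distrr; apply: eq_bigr => i _.
have -> : widen_ord (leqnSn k.+1) i = lift ord_max i.
  by apply: val_inj; rewrite /= /bump leqNgt ltn_ord.
have := compound_widen i.
have -> : widen_ord (leqnSn k.+1) i = lift ord_max i.
  by apply: val_inj; rewrite /= /bump leqNgt ltn_ord.
by rewrite liftK => ->; rewrite mulnCA.
Qed.

Lemma suitable_widen : suitable A B -> suitable A' B'.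
Proof.
by move=> [A0 B0 cop]; split=> [i|i|i j le_ji]; [apply: A0|apply: B0|apply: cop].
Qed.

(** The last generator is the product of all [B j], and every index j is at most the last one, so
    suitability applies to each factor. *)
Lemma coprime_compound_max : suitable A B -> coprime (A ord_max) (compound A B ord_max).
Proof.
move=> [_ _ cop]; rewrite compound_max; elim/big_ind: _ => [||j _].
- exact: coprimen1.
- by move=> x y; rewrite coprimeMr => -> ->.
- by apply: cop; rewrite -ltnS.
Qed.

End Truncation.

Lemma uniq_map_inj_in (T1 T2 : eqType) (f : T1 -> T2) (s : seq T1) :
  uniq (map f s) -> {in s &, injective f}.
Proof.
elim: s => //= x s IH /andP[fx us] y z.
rewrite !inE => /predU1P[->|ys] /predU1P[->|zs] // E; last exact: IH.
  by rewrite E map_f in fx.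
by rewrite -E map_f in fx.
Qed.

(** Modulo a only c b survives, and b is invertible there, which gives c = c'; the common term and
    the factor a then cancel. *)
Lemma modn_mixed_inj a g b c c' w w' : (0 < a)%N -> coprime a b ->
  (c < a)%N -> (c' < a)%N ->
  (c * b + a * w = c' * b + a * w' %[mod a * g])%N -> c = c' /\ (w = w' %[mod g])%N.
Proof.
move=> a0 cop lt_c lt_c' E.
have cc' : c = c'.
  have mod_a x y : (x + a * y = x %[mod a])%N by rewrite mulnC addnC modnMDl.
  have := congr1 (modn^~ a) E; rewrite !modn_dvdm ?dvdn_mulr // !mod_a => /eqP.
  wlog le_cc' : c c' {E} lt_c lt_c' / (c' <= c)%N.
    move=> W H; case: (leqP c' c) => [|/ltnW] ?; first exact: W.
    by symmetry; apply: W => //; rewrite eq_sym.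
  rewrite eqn_mod_dvd ?leq_mul2r ?le_cc' ?orbT // -mulnBl mulnC Gauss_dvdr //.
  by have [|d0 /(dvdn_leq d0)] := posnP (c - c')%N; lia.
split=> //; move/eqP: E; rewrite cc' eqn_modDl -!muln_modr eqn_pmul2l //.
by move/eqP.
Qed.

(* The set [s] is the Apéry set of the numerical semigroup with respect to
   [compound A B ord0]. *)
Lemma apery_exists k (A B : 'I_k -> nat) : suitable A B ->
  exists s : seq nat,
  [/\ uniq [seq w %% \prod_(i < k) A i | w <- s]%N,
      size s = (\prod_(i < k) A i)%N,
      forall n, representable A B n <->
        exists2 w, w \in s & exists q, n = (w + q * \prod_(i < k) A i)%N &
      forall (R : comPzRingType) (t : R), \sum_(w <- s) t ^+ w =
        \prod_(i < k) \sum_(c < A i) t ^+ (c * compound A B (lift ord0 i))%N].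
Proof.
elim: k A B => [|k IH] A B sAB.
  (* For empty tuples the only generator is the empty product 1, so every number is
     representable. *)
  exists [:: 0%N]; split; rewrite ?big_ord0 //.
    move=> n; split=> _.
      by exists 0%N => //; exists n; rewrite add0n muln1.
    exists (fun=> n); rewrite big_ord1 /compound !big_pred0 ?muln1 // => -[] //.
  by move=> R t; rewrite big_ord0 big_seq1.
have [A0 B0 cop] := sAB.
have [s [uniq_s size_s repr_s gf_s]] := IH _ _ (suitable_widen sAB).
set a := A ord_max; set g := compound A B ord_max.
set G := (\prod_(i < k) A (widen_ord (leqnSn k) i))%N in uniq_s size_s repr_s.
have a0 : (0 < a)%N := A0 _.
exists [seq (c * g + a * w)%N | c <- iota 0 a, w <- s].
rewrite prod_maxE -/a -/G; split.
- rewrite map_allpairs; apply: allpairs_uniq.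
  + exact: iota_uniq.
  + exact: map_uniq uniq_s.
  + move=> [c w] [c' w'] /allpairsP[[? ?] /= [lt_c w_s [-> ->]]].
    move=> /allpairsP[[? ?] /= [lt_c' w'_s [-> ->]]].
    rewrite !mem_iota !add0n /= in lt_c lt_c'.
    case/(modn_mixed_inj a0 (coprime_compound_max sAB) lt_c lt_c') => -> ww'.
    by congr pair; apply: (uniq_map_inj_in uniq_s w_s w'_s).
- by rewrite size_allpairs size_iota size_s.
- move=> n; rewrite representable_step //; split.
    move=> [c [n' [lt_c /repr_s[w w_s [q ->]] ->]]].
    exists (c * g + a * w)%N; last by exists q; rewrite -/a -/g; ring.
    by apply/allpairsP; exists (c, w); rewrite mem_iota.
  move=> [_ /allpairsP[[c w] /= [+ w_s ->]] [q ->]]; rewrite mem_iota => lt_c.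
  exists c, (w + q * G)%N; split=> //; first by apply/repr_s; exists w => //; exists q.
  by rewrite -/a -/g; ring.
- move=> R t; rewrite big_allpairs_dep big_ord_recr /= mulrC.
  have -> : lift ord0 ord_max = ord_max :> 'I_k.+2 by apply: val_inj.
  rewrite -/a -/g -[in RHS](big_mkord predT (fun c => t ^+ (c * g)%N)) mulr_suml.
  rewrite /index_iota subn0; apply: eq_bigr => c _.
  (* The induction hypothesis is used at [t ^+ a]: all generators but the last are a times those of
     the shorter pair. *)
  under eq_bigr do rewrite exprD (exprM _ a).
  rewrite -mulr_sumr gf_s; congr (_ * _); apply: eq_bigr => i _.
  have -> : lift ord0 (widen_ord (leqnSn k) i) = widen_ord (leqnSn k.+1) (lift ord0 i).
    exact: val_inj.
  by rewrite compound_widen; apply: eq_bigr => d _; rewrite -exprM mulnCA.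
Qed.

(** By counting, g distinct residues modulo g exhaust them all. *)
Lemma perm_residues s g : uniq [seq w %% g | w <- s]%N -> size s = g ->
  perm_eq [seq w %% g | w <- s]%N (iota 0 g).
Proof.
move=> us ss; apply: uniq_perm; rewrite ?iota_uniq //.
apply: (uniq_min_size us _ _).2; last by rewrite size_map size_iota ss.
move=> _ /mapP[w ws ->]; rewrite mem_iota /= add0n ltn_mod.
by rewrite -ss; case: (s) ws.
Qed.

(* Below each [w] of the Apéry set lie exactly [w %/ g] gaps congruent to it. *)
Definition gaps (s : seq nat) (g : nat) : seq nat :=
  [seq (w %% g + j * g)%N | w <- s, j <- iota 0 (w %/ g)].

Section Gaps.
Variables (s : seq nat) (g : nat).
Hypotheses (g_gt0 : (0 < g)%N) (uniq_s : uniq [seq w %% g | w <- s]%N).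
Hypothesis size_s : size s = g.

Let residue_inj : {in s &, injective (modn^~ g)} := uniq_map_inj_in uniq_s.

Let modn_addM x q : (x + q * g = x %[mod g])%N.
Proof. by rewrite addnC modnMDl. Qed.

Lemma gaps_uniq : uniq (gaps s g).
Proof.
apply: (@allpairs_uniq_dep _ (fun=> nat)) => [|w _|]; rewrite ?iota_uniq //.
  exact: map_uniq uniq_s.
move=> _ _ /allpairsPdep[w [j [ws _ ->]]] /allpairsPdep[w' [j' [ws' _ ->]]] /= E.
have ww' : (w %% g = w' %% g)%N.
  by have := congr1 (modn^~ g) E; rewrite /= !modn_addM !modn_mod.
move: E; rewrite ww' => /addnI/eqP; rewrite eqn_pmul2r // => /eqP ->.
by rewrite (residue_inj ws ws' ww').
Qed.

Lemma mem_gaps n :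
  n \in gaps s g <-> ~ exists2 w, w \in s & exists q, n = (w + q * g)%N.
Proof.
split=> [/allpairsPdep[w [j [ws +]]]|no_rep].
  rewrite mem_iota /= add0n => lt_j -> [w' ws' [q E]].
  have ww' : (w %% g = w' %% g)%N.
    by have := congr1 (modn^~ g) E; rewrite /= !modn_addM modn_mod.
  (* Equal residues force w' = w, so the supposed gap would be at least w, contradicting j <
     [w %/ g]. *)
  have : (w <= w %% g + j * g)%N by rewrite E (residue_inj ws ws' ww') leq_addr.
  rewrite {1}(divn_eq w g) addnC leq_add2l leq_pmul2r // leqNgt lt_j //.
have : (n %% g)%N \in [seq w %% g | w <- s]%N.
  by rewrite (perm_mem (perm_residues uniq_s size_s)) mem_iota ltn_mod.
case/mapP => w ws E; apply/allpairsPdep; exists w, (n %/ g)%N.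
rewrite mem_iota /= add0n -E addnC -divn_eq; split=> //.
case: (ltnP (n %/ g) (w %/ g)) => // le_q; case: no_rep; exists w => //.
exists (n %/ g - w %/ g)%N.
rewrite [LHS](divn_eq n g) E {2}(divn_eq w g) mulnBl.
have := leq_mul le_q (leqnn g); lia.
Qed.

(** For each w the progression of ratio t^g telescopes to t^w - t^(w mod g), and the residues w mod
    g run through all r < g. *)
Lemma sum_gaps (R : comPzRingType) (t : R) :
  (\sum_(n <- gaps s g) t ^+ n) * (t ^+ g - 1) =
  \sum_(w <- s) t ^+ w - \sum_(r < g) t ^+ r.
Proof.
rewrite -[X in _ = _ - X](big_mkord predT (fun r => t ^+ r)) /index_iota subn0.
rewrite -(perm_big _ (perm_residues uniq_s size_s)) big_map -sumrB.
rewrite big_allpairs_dep mulr_suml; apply: eq_bigr => w _ /=.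
under eq_bigr do rewrite exprD mulnC exprM.
rewrite -mulr_sumr -{1}[(w %/ g)%N]subn0 -/(index_iota _ _) big_mkord.
rewrite -mulrA [X in _ * X]mulrC -subrX1 mulrBr mulr1 -exprM -exprD.
by rewrite addnC mulnC -divn_eq.
Qed.

End Gaps.

(** * Generating series of the gaps *)

Lemma compound0 k (A B : 'I_k -> nat) : compound A B ord0 = (\prod_(i < k) A i)%N.
Proof. by rewrite /compound big_pred0 ?mul1n. Qed.

Lemma compound_gt0 k (A B : 'I_k -> nat) i : suitable A B -> (0 < compound A B i)%N.
Proof.
by move=> [A0 B0 _]; rewrite muln_gt0; apply/andP; split; rewrite prodn_cond_gt0.
Qed.

Lemma gap_series k (A B : 'I_k -> nat) : suitable A B ->
  exists2 s : seq nat, uniq s /\ NR A B = [set` s]%classic &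
    (\sum_(n <- s) fe ^+ n) * fX =
      (\prod_(i < k.+1) fscale (compound A B i) fB) *
      (\prod_(j < k) fscale (A j * compound A B (lift ord0 j)) fE) - fB.
Proof.
move=> sAB; have [s [uniq_s size_s repr_s gf_s]] := apery_exists sAB.
set g := (\prod_(i < k) A i)%N in uniq_s size_s repr_s.
have g0 : (0 < g)%N by rewrite /g -(compound0 A B) compound_gt0.
exists (gaps s g).
  split; first exact: gaps_uniq.
  by apply/seteqP; split=> n; rewrite /NR /= repr_s => ?; apply/(mem_gaps g0 uniq_s size_s).
have := sum_gaps uniq_s size_s fe; rewrite gf_s feX_sub1.
under [X in _ = X - _]eq_bigr do rewrite (sum_feX _ (compound_gt0 _ sAB)).
(* The sum of the e^(rz) over r < g is the case of step 1 of [sum_feX], hence g E(gz) B(z). *)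
under [X in _ = _ - X]eq_bigr do rewrite -[X in fe ^+ X]muln1.
rewrite sum_feX // muln1 fscale_id prodrMn -/g -mulrnBl big_split /=.
rewrite mulrnAr => /(fps_mulIn g0); rewrite mulrA mulrAC.
(* Multiplication by B(gz) removes E(gz) on the left and next to B(z), and supplies the factor i = 0
   of the product, as g = g_0. *)
move/(congr1 ( *%R (fscale g fB))); rewrite mulrCA fB_fE mulr1 => ->.
rewrite mulrBr [X in _ - X]mulrA fB_fE mul1r big_ord_recl compound0 -/g -mulrA.
by congr (_ * _ - _); apply: mulrC.
Qed.

(** Exponents are compared base by base: a_i divides out of g_l for l < i and b_i for l >= i as
    listed factors, while a_j g_j = b_1 ... b_j a_j ... a_k contains a_i for j <= i and b_i for j >=
    i. *)
Lemma compound_exponents k (A B : 'I_k -> nat) (x : 'I_k.+1 -> nat) (y : 'I_k -> nat) :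
  ((\prod_(i < k.+1) compound A B i ^ x i) *
   (\prod_(j < k) (A j * compound A B (lift ord0 j)) ^ y j) =
  \prod_(i < k) (A i ^ alpha x y i * B i ^ beta x y i))%N.
Proof.
(* Conditions on the index become exponents 0 or 1, so that the products can be exchanged. *)
have expnP (P : pred 'I_k) (F : 'I_k -> nat) e :
    ((\prod_(j < k | P j) F j) ^ e = \prod_(j < k) F j ^ (P j * e))%N.
  rewrite (big_morph _ (fun a b => expnMn a b e) (exp1n e)) big_mkcond; apply: eq_bigr => j _.
  by case: (P j); rewrite ?mul1n.
have stepE j : (A j * compound A B (lift ord0 j) =
    (\prod_(l < k | (l <= j)%N) B l) * (\prod_(l < k | (j <= l)%N) A l))%N.
  rewrite [X in _ = (_ * X)%N](bigD1 j) //= mulnCA; congr (_ * (_ * _))%N.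
  by apply: eq_bigl => l; rewrite lift0 ltn_neqAle andbC eq_sym.
have alphaE i : alpha x y i = (\sum_(l < k.+1) (l <= i) * x l + \sum_(l < k) (l <= i) * y l)%N.
  rewrite /alpha big_mkcond big_ord_recr /= leqNgt ltn_ord mul0n addn0 -big_split.
  by apply: eq_bigr => l _ /=; case: (l <= i)%N; rewrite ?mul1n.
have betaE i : beta x y i = (\sum_(l < k.+1) (i < l) * x l + \sum_(l < k) (i <= l) * y l)%N.
  rewrite /beta big_mkcond big_ord_recl /= mul0n add0n -big_split.
  by apply: eq_bigr => l _ /=; rewrite /bump leq0n add1n ltnS; case: (i <= l)%N; rewrite ?mul1n.
under eq_bigr do rewrite /compound expnMn !expnP -big_split /=.
under [X in (_ * X)%N]eq_bigr do rewrite stepE expnMn !expnP -big_split /=.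
rewrite exchange_big [X in (_ * X)%N]exchange_big -big_split; apply: eq_bigr => i _ /=.
by rewrite !big_split /= alphaE betaE !expnD !expn_sum [LHS]mulnACA mulnC.
Qed.

(* The index types bound the x_i and y_j by m, which their sum being m forces. *)
Theorem theorem3p10 (k : nat) (A B : 'I_k -> nat) (m : nat)
    (hAB : suitable A B) (hm : (1 <= m)%N) :
  power_sum_NR m.-1 A B =
    (m`!)%:R / m%:R *
    (\sum_(x : {ffun 'I_k.+1 -> 'I_m.+1})
      \sum_(y : {ffun 'I_k -> 'I_m.+1} |
            (\sum_(i < k.+1) x i + \sum_(j < k) y j == m)%N)
        (\prod_(i < k.+1) (bernoulli (x i) / ((x i)`!)%:R)) *
        ((\prod_(i < k)
            ((A i)%:R ^+ alpha (fun l => x l) (fun l => y l) i *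
             (B i)%:R ^+ beta (fun l => x l) (fun l => y l) i)) /
         (\prod_(j < k) ((y j).+1`!)%:R)))
    - bernoulli m / m%:R.
Proof.
(* From here on [m] stands for the exponent m - 1 of the power sum. *)
case: m hm => // m _.
have [s [uniq_s NRs] /(congr1 (fun f : fps => f m.+1))] := gap_series hAB.
rewrite fps_mulXS fpsB fps_prod2E => E.
(* The coefficient of z^m in e^(nz) is n^m / m!. *)
have -> : power_sum_NR m A B = (m`!)%:R * (\sum_(n <- s) fe ^+ n) m.
  rewrite /power_sum_NR NRs -fsbig_seq // fps_sum mulr_sumr.
  by apply: eq_bigr => n _; rewrite feX /fscale mulrCA divff ?mulr1 ?fact_neq0.
have m0 : m.+1%:R != 0 :> rat by rewrite pnatr_eq0.
have -> : (m.+1`!)%:R / m.+1%:R = (m`!)%:R :> rat.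
  by rewrite factS natrM mulrAC divff ?mul1r.
rewrite E mulrBr; congr (_ * _ - _); last first.
  rewrite /fB /fps_egf factS natrM invfM mulrCA; congr (_ * _).
  by rewrite mulrCA divff ?fact_neq0 ?mulr1.
apply: eq_bigr => x _; apply: eq_bigr => y _.
under [X in _ = _ * (X / _)]eq_bigr do rewrite -!natrX -natrM.
rewrite -natr_prod -compound_exponents natrM !natr_prod -prodfV.
under [X in _ = _ * (X * _ * _)]eq_bigr do rewrite natrX.
under [X in _ = _ * (_ * X * _)]eq_bigr do rewrite natrX.
by rewrite -mulrA mulrA -!big_split /=; congr (_ * _); apply: eq_bigr => i _; rewrite mulrC.
Qed.
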